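(* Let $(A, d_1, \ldots, d_N)$ be an AssHDer pair of rank $N$. If $H^2_{\mathrm{AssHDer}}(A, A) = 0$, then every formal one-parameter deformation of the AssHDer pair $(A, d_1, \ldots, d_N)$ is trivial.
   Context: All vector spaces and linear maps are over a field $\mathbb{K}$ of characteristic zero. Algebras are associative, not assumed unital. Fix an integer $N \ge 1$. A higher derivation of rank $N$ on an associative algebra $A$ is a sequence $\{d_1, \ldots, d_N\}$ of linear maps $A \to A$ with $d_k(ab) = \sum_{i+j=k} d_i(a) d_j(b)$ for $1 \le k \le N$, $a,b\in A$, where $i,j\ge 0$ and $d_0 = \mathrm{id}_A$. An AssHDer pair of rank $N$ is a tuple $(A, d_1, \ldots, d_N)$ of an associative algebra and a higher derivation of rank $N$ on it. Write $\mu$ for the multiplication of $A$. Cohomology with coefficients in itself ($M = A$ with its own multiplication as bimodule actions and $d_k^M = d_k$). For $f \in \mathrm{Hom}(A^{\otimes n}, A)$, $n\ge 1$, $\delta_{\mathrm{Hoch}} f$ is the Hochschild coboundary $(\delta_{\mathrm{Hoch}} f)(a_1, \ldots, a_{n+1}) = a_1 f(a_2, \ldots, a_{n+1}) + \sum_{i=1}^n (-1)^i f(a_1, \ldots, a_i a_{i+1}, \ldots, a_{n+1}) + (-1)^{n+1} f(a_1, \ldots, a_n) a_{n+1}$, and $\delta_k f = \sum_{i_1 + \cdots + i_n = k,\ i_l\ge 0} f \circ (d_{i_1} \otimes \cdots \otimes d_{i_n}) - d_k \circ f$ for $1\le k\le N$. For a tuple $(f_1, \ldots, f_N)$ in $\mathrm{Hom}(A^{\otimes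 n}, A)$ and $1\le k\le N$, $\delta'_{\mathrm{Hoch}}(f_k)(a_1, \ldots, a_{n+1}) = \sum_{i+j=k,\ i \ge 0,\ j \ge 1} d_i(a_1) f_j(a_2, \ldots, a_{n+1}) + \sum_{i=1}^n (-1)^i f_k(a_1, \ldots, a_i a_{i+1}, \ldots, a_{n+1}) + (-1)^{n+1} \sum_{i+j=k,\ i \ge 1,\ j \ge 0} f_i(a_1, \ldots, a_n) d_j(a_{n+1})$. Set $C^0_{\mathrm{AssHDer}}(A,A) = 0$, $C^1_{\mathrm{AssHDer}}(A, A) = \mathrm{Hom}(A, A)$, and $C^n_{\mathrm{AssHDer}}(A, A) = \mathrm{Hom}(A^{\otimes n}, A) \times \mathrm{Hom}(A^{\otimes n-1}, A)^{N}$ for $n \ge 2$. The differential is $\partial f = (\delta_{\mathrm{Hoch}} f; -\delta_1 f, \ldots, -\delta_N f)$ for $f\in C^1$, and $\partial(f; f_1, \ldots, f_N) = (\delta_{\mathrm{Hoch}} f; \delta'_{\mathrm{Hoch}} f_1 + (-1)^n \delta_1 f, \ldots, \delta'_{\mathrm{Hoch}} f_N + (-1)^n \delta_N f)$ for $(f; f_1, \ldots, f_N) \in C^n$, $n \ge 2$. $H^\ast_{\mathrm{AssHDer}}(A, A)$ is the cohomology of this complex. Deformations. A formal one-parameter deformation of $(A, d_1, \ldots, d_N)$ consists of formal power series $\mu_t = \sum_{i\ge 0} t^i \mu_i \in \mathrm{Hom}(A^{\otimes 2}, A)[[t]]$ with $\mu_0 = \mu$ and $d_{k,t} = \sum_{i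 \ge 0} t^i d_{k,i} \in \mathrm{Hom}(A,A)[[t]]$ with $d_{k,0} = d_k$, $1\le k\le N$, such that $(A[[t]], \mu_t)$ is an associative algebra over $\mathbb{K}[[t]]$ and $\{d_{1,t}, \ldots, d_{N,t}\}$ is a higher derivation of rank $N$ on it (all maps extended $\mathbb{K}[[t]]$-linearly and $t$-adically to $A[[t]]$; $d_{0,t} = \mathrm{id}$). Two deformations $(\mu_t; d_{1,t}, \ldots, d_{N,t})$ and $(\mu_t'; d_{1,t}', \ldots, d_{N,t}')$ are equivalent if there is a formal isomorphism $\Phi_t = \sum_{i\ge 0} t^i \Phi_i : A[[t]] \to A[[t]]$ with $\Phi_i \in \mathrm{Hom}(A,A)$, $\Phi_0 = \mathrm{id}_A$, such that $\Phi_t \circ \mu_t = \mu_t' \circ (\Phi_t \otimes \Phi_t)$ and $d_{k,t}' \circ \Phi_t = \Phi_t \circ d_{k,t}$ for $1\le k\le N$. A deformation is trivial if it is equivalent to the undeformed one $(\mu_t' = \mu; d_{1,t}' = d_1, \ldots, d_{N,t}' = d_N)$. *)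

(* Defs.v *)
From HB Require Import structures.
From mathcomp Require Import all_boot all_order all_algebra.
From mathcomp Require Import boolp classical_sets functions.

Set Implicit Arguments.
Unset Strict Implicit.
Unset Printing Implicit Defensive.

Import GRing.Theory.
Local Open Scope ring_scope.

(* Algebras need not be unital, so an algebra is a vector space V : lmodType K
   together with a bilinear associative map mu : V -> V -> V.  Function spaces
   carry the pointwise vector space structure. *)

Notation bilinear_op := (bilinear_for *:%R *:%R).

(* A sequence (d_1, ..., d_N) is stored as a family d over 'I_N, the ordinal k
   standing for the index k+1.  der d m is d_m for 1 <= m <= N, and d_0 = id;
   the value 0 for m > N is never used. *)
Definition der (V : nmodType) (N : nat) (d : 'I_N -> V -> V) (m : nat) : V -> V :=
  if m is m'.+1 then oapp d (fun=> 0) (insub m') else idfun.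

Definition higher_derivation (K : fieldType) (V : lmodType K) (N : nat)
    (mu : V -> V -> V) (d : 'I_N -> V -> V) : Prop :=
  (forall k, linear (d k)) /\
  (forall (k : 'I_N) (a b : V),
     d k (mu a b) = \sum_(i < k.+2) mu (der d i a) (der d (k.+1 - i) b)).

Record AssHDer_pair (K : fieldType) (V : lmodType K) (N : nat)
    (mu : V -> V -> V) (d : 'I_N -> V -> V) : Prop := {
  AssHDer_bilinear : bilinear_op mu;
  AssHDer_associative : associative mu;
  AssHDer_higher_derivation : higher_derivation mu d }.

Section Cohomology.
Variables (K : fieldType) (A : lmodType K) (N : nat).
Variables (mu : A -> A -> A) (d : 'I_N -> A -> A).

(* Hom(A^{(x) n}, A) is the space of multilinear maps among all maps A^n -> A:
   the coboundary formulas are written for arbitrary maps, and multilinearity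
   is imposed by is_cochain below. *)
Definition nary (n : nat) : lmodType K := (('I_n -> A) -> A).

Definition multilinear (n : nat) (f : nary n) : Prop :=
  forall (a : 'I_n -> A) (i : 'I_n),
    linear (fun u : A => f (fun l => if l == i then u else a l)).

(* (a_0, ..., a_n) |-> (a_0, ..., a_i a_{i+1}, ..., a_n), indices from 0 *)
Definition merge (n : nat) (i : 'I_n) (a : 'I_n.+1 -> A) : 'I_n -> A :=
  fun l => if (l < i)%N then a (lift ord_max l)
           else if l == i then mu (a (lift ord_max i)) (a (lift ord0 i))
           else a (lift ord0 l).

Definition behead_arg (n : nat) (a : 'I_n.+1 -> A) : 'I_n -> A :=
  fun l => a (lift ord0 l).

Definition belast_arg (n : nat) (a : 'I_n.+1 -> A) : 'I_n -> A :=
  fun l => a (lift ord_max l).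

Definition delta_Hoch (n : nat) (f : nary n) : nary n.+1 := fun a =>
  mu (a ord0) (f (behead_arg a))
  + \sum_(i < n) (-1) ^+ i.+1 *: f (merge i a)
  + (-1) ^+ n.+1 *: mu (f (belast_arg a)) (a ord_max).

(* the operator delta_{k+1} *)
Definition delta (n : nat) (k : 'I_N) (f : nary n) : nary n := fun a =>
  \sum_(i : {ffun 'I_n -> 'I_k.+2} | (\sum_l i l)%N == k.+1)
     f (fun l => der d (i l) (a l))
  - d k (f a).

(* delta'_Hoch (f_{k+1}); the indices i + j = k + 1 with j >= 1 (resp. i >= 1)
   become j' = j - 1 <= k and i = k - j' (resp. with i and j exchanged) *)
Definition delta_Hoch' (n : nat) (f : 'I_N -> nary n) (k : 'I_N) : nary n.+1 :=
  fun a =>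
  \sum_(j < N | (j <= k)%N) mu (der d (k - j) (a ord0)) (f j (behead_arg a))
  + \sum_(i < n) (-1) ^+ i.+1 *: f k (merge i a)
  + (-1) ^+ n.+1 *:
      \sum_(i < N | (i <= k)%N) mu (f i (belast_arg a)) (der d (k - i) (a ord_max)).

(* C^n without the multilinearity condition; 'rV_0 is the zero space *)
Definition precochain (n : nat) : lmodType K :=
  match n return lmodType K with
  | 0 => 'rV[K]_0
  | 1 => nary 1
  | m.+2 => (nary m.+2 * ('I_N -> nary m.+1))%type
  end.

Definition is_cochain (n : nat) : set (precochain n) :=
  match n return set (precochain n) with
  | 0 => setT
  | 1 => fun f => multilinear f
  | m.+2 => fun c => multilinear c.1 /\ forall k, multilinear (c.2 k)
  end.

Definition differential (n : nat) : precochain n -> precochain n.+1 :=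
  match n return precochain n -> precochain n.+1 with
  | 0 => fun _ => 0
  | 1 => fun f => (delta_Hoch f, fun k => - delta k f)
  | m.+2 => fun c =>
      (delta_Hoch c.1, fun k => delta_Hoch' c.2 k + (-1) ^+ m.+2 *: delta k c.1)
  end.

Definition cocycles (n : nat) : set (precochain n) :=
  [set c | is_cochain c /\ differential c = 0]%classic.

Definition coboundaries (n : nat) : set (precochain n) :=
  match n return set (precochain n) with
  | 0 => [set 0]%classic
  | m.+1 => (@differential m @` @is_cochain m)%classic
  end.

(* H^n = cocycles / coboundaries is zero *)
Definition cohomology_eq0 (n : nat) : Prop :=
  (@cocycles n `<=` @coboundaries n)%classic.

End Cohomology.

Section Deformation.
Variables (K : fieldType) (A : lmodType K) (N : nat).

(* V[[t]], as sequences of coefficients *)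
Definition pseries (V : lmodType K) : lmodType K := (nat -> V).

Definition const_series (V : lmodType K) (v : V) : pseries V :=
  fun n => if n is 0 then v else 0.

(* t-adic K[[t]]-(bi)linear extensions to A[[t]] of sum_i t^i f_i and of
   sum_i t^i m_i *)
Definition extend1 (f : nat -> A -> A) (x : pseries A) : pseries A := fun n =>
  \sum_(i < n.+1) f i (x (n - i)%N).

Definition extend2 (m : nat -> A -> A -> A) (x y : pseries A) : pseries A :=
  fun n => \sum_(i < n.+1) \sum_(j < (n - i).+1) m i (x j) (y (n - i - j)%N).

(* dt k i is the coefficient d_{k+1,i}.  In deform_AssHDer, A[[t]] is regarded as
   a K-space; the maps are K[[t]]-(bi)linear because they are t-adic extensions. *)
Record deformation (mu : A -> A -> A) (d : 'I_N -> A -> A)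
    (mut : nat -> A -> A -> A) (dt : 'I_N -> nat -> A -> A) : Prop := {
  deform_bilinear : forall i, bilinear_op (mut i);
  deform_linear : forall k i, linear (dt k i);
  deform_mu0 : mut 0%N = mu;
  deform_d0 : forall k, dt k 0%N = d k;
  deform_AssHDer : AssHDer_pair (extend2 mut) (fun k => extend1 (dt k)) }.

Definition equivalent_deformations
    (mut : nat -> A -> A -> A) (dt : 'I_N -> nat -> A -> A)
    (mut' : nat -> A -> A -> A) (dt' : 'I_N -> nat -> A -> A) : Prop :=
  exists Phi : nat -> A -> A,
    [/\ forall i, linear (Phi i),
        Phi 0%N = idfun,
        bijective (extend1 Phi),
        forall x y, extend1 Phi (extend2 mut x y)
                    = extend2 mut' (extend1 Phi x) (extend1 Phi y)
      & forall k x, extend1 (dt' k) (extend1 Phi x)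
                    = extend1 Phi (extend1 (dt k) x)].

Definition trivial_deformation (mu : A -> A -> A) (d : 'I_N -> A -> A)
    (mut : nat -> A -> A -> A) (dt : 'I_N -> nat -> A -> A) : Prop :=
  equivalent_deformations mut dt
    (const_series mu) (fun k => const_series (d k)).

End Deformation.

(* Main.v *)
(* The coefficients of an equivalence [Phi = sum_i t^i Phi_i] to the undeformed
   pair are built one at a time.  Put [F(x,y) = Phi (mu_t(x,y)) - mu(Phi x, Phi y)]
   and [G_k(x) = Phi (d_{k,t} x) - d_k (Phi x)].  Associativity of [mu_t] and [mu]
   gives
     [mu(F(x,y), Phi z) + F(mu_t(x,y), z) = mu(Phi x, F(y,z)) + F(x, mu_t(y,z))],
   and the derivation rules give a similar identity for [F] and [G_k].  If [F] and
   the [G_k] vanish below order [n], these identities at order [n] say that the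
   [t^n]-coefficients of [(F; G_1, ..., G_N)] form a 2-cocycle.  It is the
   differential of some [f], and adding [f] to [Phi_n] kills it. *)

Require Import Defs.
From HB Require Import structures.
From mathcomp Require Import all_boot all_order all_algebra.
From mathcomp Require Import boolp classical_sets functions.

Import GRing.Theory.
Local Open Scope ring_scope.

(** * Additivity of maps satisfying the predicate [linear] *)

Section Linear.
Set Implicit Arguments.
Unset Strict Implicit.
Variables (K : fieldType) (U V : lmodType K) (f : U -> V).
Hypothesis f_lin : linear f.

Let f_bundled : {linear U -> V} :=
  HB.pack f (@GRing.isLinear.Build K U V *:%R f f_lin).

Lemma linear_map0 : f 0 = 0. Proof. exact: (raddf0 f_bundled). Qed.
Lemma linear_mapD x y : f (x + y) = f x + f y.
Proof. exact: (raddfD f_bundled). Qed.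
Lemma linear_mapB x y : f (x - y) = f x - f y.
Proof. exact: (raddfB f_bundled). Qed.
End Linear.

(** This is the engine for all coefficient-by-coefficient constructions: inverses of formal series
    and the equivalence [Phi]. A condition of index [n] sees only the entries up to [n], so later
    choices cannot spoil it. *)
Lemma dependent_sequence (T : Type) (t0 : T) (P : nat -> (nat -> T) -> Prop) :
    (forall n u v, (forall i, (i <= n)%N -> u i = v i) -> P n u -> P n v) ->
    (forall n u, (forall m, (m < n)%N -> P m u) ->
      exists t, P n (fun i => if i == n then t else u i)) ->
  exists u, forall n, P n u.
Proof.
move=> P_causal P_step.
pose upd n u t : nat -> T := fun i => if i == n then t else u i.
have [g gP] : {g : nat * (nat -> T) -> T & forall p,
    (forall m, (m < p.1)%N -> P m p.2) -> P p.1 (upd p.1 p.2 (g p))}.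
  apply: (@choice _ _ (fun p t =>
    (forall m, (m < p.1)%N -> P m p.2) -> P p.1 (upd p.1 p.2 t))) => -[n u] /=.
  (* Choice needs a value at every pair, so [t0] fills in where the earlier conditions fail. *)
  have [Pu|nPu] := pselect (forall m, (m < n)%N -> P m u); last by exists t0.
  by have [t Pt] := P_step n u Pu; exists t.
(* [w n] is the sequence after [n] updates, started from the constant [t0]; its entries below [n]
   are final. *)
pose w := fix w n := if n is m.+1 then upd m (w m) (g (m, w m)) else fun=> t0.
have w_stable n k i : (i < n)%N -> w (k + n)%N i = w n i.
  move=> lt_in; elim: k => //= k <-; rewrite /upd ifN // neq_ltn.
  by rewrite (leq_trans lt_in) // leq_addl.
have w_good n m : (m < n)%N -> P m (w n).
  elim: n m => // n IHn m; rewrite ltnS => le_mn.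
  move: (le_mn); rewrite leq_eqVlt => /orP[/eqP->|lt_mn].
    by apply: (gP (n, w n)) => /= j; exact: IHn.
  apply: P_causal (IHn m lt_mn) => i le_im.
  by rewrite -(w_stable n 1%N) // (leq_ltn_trans le_im).
(* The diagonal limit: entry [i] is set at stage [i.+1] and never changes again. *)
exists (fun i => w i.+1 i) => n.
apply: P_causal (w_good n.+1 n (ltnSn n)) => i le_in.
by rewrite -(w_stable i.+1 (n - i)%N) // addnS subnK.
Qed.

(** * Operators on A[[t]] that commute with t *)

Section Series.
Set Implicit Arguments.
Unset Strict Implicit.
Variables (K : fieldType) (A : lmodType K).
Implicit Types (x y : pseries A) (S T : pseries A -> pseries A).

(* multiplication by [t] *)
Definition tmul x : pseries A := fun n => if n is m.+1 then x m else 0.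

(** Commuting with [tmul] makes T map t^n A[[t]] into itself, so t-adic continuity need not be
    imposed separately. *)
Definition tlinear T : Prop := linear T /\ forall x, T (tmul x) = tmul (T x).

Lemma coefD x y n : (x + y) n = x n + y n. Proof. by []. Qed.
Lemma coefN x n : (- x) n = - x n. Proof. by []. Qed.
Lemma coefZ c x n : (c *: x) n = c *: x n. Proof. by []. Qed.

Lemma tmulE x : x 0%N = 0 -> x = tmul (fun n => x n.+1).
Proof. by move=> x0; apply/funext => -[]. Qed.

Lemma pseries_split x : x = const_series (x 0%N) + tmul (fun n => x n.+1).
Proof. by apply/funext => -[|n]; rewrite coefD /= ?addr0 ?add0r. Qed.

Lemma linear_const_series : linear (@const_series K A).
Proof.
by move=> c a b; apply/funext => -[|n]; rewrite coefD coefZ //= scaler0 addr0.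
Qed.

Lemma tlinear_id : tlinear idfun. Proof. by []. Qed.

Lemma tlinear0 : tlinear (fun=> 0).
Proof.
by split=> [c x y|x]; [rewrite scaler0 addr0 | apply/funext => -[]].
Qed.

Lemma tlinear_comp S T : tlinear S -> tlinear T -> tlinear (fun x => S (T x)).
Proof.
by move=> [linS tS] [linT tT]; split=> [c x y|x]; rewrite ?linT ?linS ?tT ?tS.
Qed.

Lemma tlinear_add S T : tlinear S -> tlinear T -> tlinear (fun x => S x + T x).
Proof.
move=> [linS tS] [linT tT]; split=> [c x y|x].
  by rewrite linS linT scalerDr addrACA.
by rewrite tS tT; apply/funext => -[|n]; rewrite !coefD //= addr0.
Qed.

Lemma tlinear_opp T : tlinear T -> tlinear (fun x => - T x).
Proof.
move=> [linT tT]; split=> [c x y|x]; first by rewrite linT opprD scalerN.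
by rewrite tT; apply/funext => -[|n]; rewrite !coefN //= oppr0.
Qed.

Lemma tlinear_sub S T : tlinear S -> tlinear T -> tlinear (fun x => S x - T x).
Proof. by move=> tS tT; apply/tlinear_add/tlinear_opp. Qed.

Lemma tlinear_sum (I : finType) (T : I -> pseries A -> pseries A) :
  (forall i, tlinear (T i)) -> tlinear (fun x => \sum_i T i x).
Proof.
move=> tT; elim: (index_enum I) => [|i r IHr].
  rewrite (_ : (fun x => _) = fun=> 0); first exact: tlinear0.
  by apply/funext => x; rewrite big_nil.
rewrite (_ : (fun x => _) = fun x => T i x + \sum_(j <- r) T j x).
  exact: tlinear_add.
by apply/funext => x; rewrite big_cons.
Qed.

Lemma tlinear_coefficientwise (f : A -> A) :
  linear f -> tlinear (fun x n => f (x n)).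
Proof.
move=> linf; split=> [c x y|x]; first by apply/funext => n; exact: linf.
by apply/funext => -[|n] //=; exact: linear_map0.
Qed.

(* The operator [\sum_i t^i T_i]. *)
Lemma tlinear_tsum (T : nat -> pseries A -> pseries A) :
  (forall i, tlinear (T i)) ->
  tlinear (fun x n => \sum_(i < n.+1) T i x (n - i)%N).
Proof.
move=> tT; split=> [c x y|x]; apply/funext.
  move=> n; rewrite coefD coefZ scaler_sumr -big_split /=.
  by apply: eq_bigr => i _; rewrite (tT i).1.
case=> [|n]; first by rewrite big_ord1 (tT _).2.
rewrite big_ord_recr /= subnn (tT _).2 addr0; apply: eq_bigr => i _.
by rewrite (tT _).2 subSn // -ltnS.
Qed.

Lemma tlinear_extend1 (f : nat -> A -> A) :
  (forall i, linear (f i)) -> tlinear (extend1 f).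
Proof.
move=> linf.
exact: (@tlinear_tsum (fun i x n => f i (x n))
          (fun i => tlinear_coefficientwise (linf i))).
Qed.

Lemma tlinear_extend2r (m : nat -> A -> A -> A) x :
  (forall i, bilinear_op (m i)) -> tlinear (extend2 m x).
Proof.
move=> blm; apply: (@tlinear_tsum (fun i => extend1 (fun j => m i (x j)))) => i.
by apply: tlinear_extend1 => j; apply: (blm i).2.
Qed.

Lemma tlinear_extend2l (m : nat -> A -> A -> A) y :
  (forall i, bilinear_op (m i)) -> tlinear (fun x => extend2 m x y).
Proof.
move=> blm.
(* Reversing the inner sum lets the coefficients of [y] index the operators and those of [x] be the
   argument, the shape required by [tlinear_tsum]. *)
have -> : (fun x => extend2 m x y) = fun x n =>
    \sum_(i < n.+1) extend1 (fun j a => m i a (y j)) x (n - i)%N.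
  apply/funext => x; apply/funext => n; apply: eq_bigr => i _.
  rewrite (reindex_inj rev_ord_inj); apply: eq_bigr => j _ /=.
  by rewrite subSS subKn // -ltnS.
apply: (@tlinear_tsum (fun i => extend1 (fun j a => m i a (y j)))) => i.
by apply: tlinear_extend1 => j; apply: (blm i).1.
Qed.

Lemma extend1_causal (f g : nat -> A -> A) x y n :
    (forall i, (i <= n)%N -> f i = g i) -> (forall i, (i <= n)%N -> x i = y i) ->
  extend1 f x n = extend1 g y n.
Proof.
by move=> fg xy; apply: eq_bigr => i _; rewrite fg ?xy ?leq_subr // -ltnS.
Qed.

Lemma extend2_causal (m : nat -> A -> A -> A) x x' y y' n :
    (forall i, (i <= n)%N -> x i = x' i) -> (forall i, (i <= n)%N -> y i = y' i) ->
  extend2 m x y n = extend2 m x' y' n.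
Proof.
move=> xx' yy'; apply: eq_bigr => i _; apply: eq_bigr => j _.
rewrite xx' ?yy' //; first by rewrite -subnDA leq_subr.
by rewrite (leq_trans _ (leq_subr i n)) // -ltnS.
Qed.

Lemma extend1_coef0 (f : nat -> A -> A) x : extend1 f x 0%N = f 0%N (x 0%N).
Proof. exact: big_ord1. Qed.

Lemma extend2_coef0 (m : nat -> A -> A -> A) x y :
  extend2 m x y 0%N = m 0%N (x 0%N) (y 0%N).
Proof. by rewrite /extend2 !big_ord1. Qed.

Lemma extend1_const (f : nat -> A -> A) a :
  (forall i, linear (f i)) -> extend1 f (const_series a) = f^~ a.
Proof.
move=> linf; apply/funext => n; rewrite /extend1 big_ord_recr /= subnn big1 ?add0r //.
move=> i _; rewrite -(subnSK (ltn_ord i)) /=; exact: linear_map0.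
Qed.

Lemma extend2_const (m : nat -> A -> A -> A) a b :
    (forall i, bilinear_op (m i)) ->
  extend2 m (const_series a) (const_series b) = (m^~ a)^~ b.
Proof.
move=> blm; apply/funext => n; rewrite /extend2 big_ord_recr /= subnn big_ord1 /=.
rewrite big1 ?add0r // => i _; rewrite -(subnSK (ltn_ord i)) /=.
rewrite big_ord_recl /= (linear_map0 ((blm i).2 a)) add0r big1 // => j _.
exact: (linear_map0 ((blm i).1 _)).
Qed.

(* If [x = t^n y], the coefficient of [t^n] in [T x] is the constant term of
   [T y]. *)
Lemma tlinear_order T x n :
    tlinear T -> (forall m, (m < n)%N -> x m = 0) ->
  T x n = T (fun m => x (n + m)%N) 0%N.
Proof.
move=> [_ tT]; elim: n x => [//|n IHn] x x0.
by rewrite (@tmulE x) ?x0 // tT /= IHn // => m lt_mn; rewrite x0.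
Qed.

(* This reduces identities between [t]-linear maps, order by order in [t], to
   constant series. *)
Lemma tlinear_lead T n :
    tlinear T -> (forall a m, (m < n)%N -> T (const_series a) m = 0) ->
  forall x m, (m <= n)%N -> T x m = T (const_series (x 0%N)) m.
Proof.
move=> [linT tT] T0 x m; elim: m x => [|m IHm] x le_mn.
  by rewrite {1}(pseries_split x) (linear_mapD linT) tT coefD /= [LHS]addr0.
(* With x = x_0 + t x', the tail contributes the coefficient of order [m] of T x'. By induction it
   equals that of a constant series, and it vanishes because [m < n]. *)
rewrite {1}(pseries_split x) (linear_mapD linT) tT coefD /= IHm ?(ltnW le_mn) //.
by rewrite (T0 _ m) // addr0.
Qed.

Lemma bitlinear_lead (B : pseries A -> pseries A -> pseries A) n :
    (forall y, tlinear (B^~ y)) -> (forall x, tlinear (B x)) ->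
    (forall a b m, (m < n)%N -> B (const_series a) (const_series b) m = 0) ->
  forall x y m, (m <= n)%N ->
    B x y m = B (const_series (x 0%N)) (const_series (y 0%N)) m.
Proof.
move=> tBl tBr B0 x y m le_mn.
(* Reduce in [x] first. This requires B(a, y) to vanish below order [n] for an arbitrary series [y],
   which is the reduction in [y] at lower orders. *)
rewrite (tlinear_lead (tBl y) _ x le_mn) => [|a j lt_jn].
  exact: tlinear_lead (tBr _) (B0 _) _ _ le_mn.
by rewrite (tlinear_lead (tBr _) (B0 a) y (ltnW lt_jn)) B0.
Qed.

Lemma tlinear_eq S T :
    tlinear S -> tlinear T ->
    (forall a, S (const_series a) = T (const_series a)) ->
  forall x, S x = T x.
Proof.
move=> tS tT ST x; apply/funext => n; apply/eqP; rewrite -subr_eq0; apply/eqP.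
have ST0 a m : S (const_series a) m - T (const_series a) m = 0.
  by rewrite ST subrr.
rewrite -(ST0 (x 0%N) n).
exact: tlinear_lead (tlinear_sub tS tT) (fun a m (_ : (m < n)%N) => ST0 a m) x _ _.
Qed.

(** As f_0 = id, the equation f(y) = x is unitriangular: y_{n+1} is x_{n+1} minus terms in y_0, ...,
    y_n. Strong induction gives uniqueness, recursion gives existence. *)
Lemma extend1_bijective (f : nat -> A -> A) :
  (forall i, linear (f i)) -> f 0%N = idfun -> bijective (extend1 f).
Proof.
move=> linf f0.
have coefS x n : extend1 f x n.+1 = x n.+1 + \sum_(i < n.+1) f i.+1 (x (n - i)%N).
  by rewrite /extend1 big_ord_recl /= f0.
have inj_f : injective (extend1 f).
  move=> x y fxy; apply/funext => n; have [m] := ubnP n.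
  elim: m n => // m IHm [|n] lt_nm.
    by have /(congr1 (@^~ 0%N)) := fxy; rewrite !extend1_coef0 f0.
  have /(congr1 (@^~ n.+1)) := fxy; rewrite !coefS.
  rewrite (eq_bigr (fun i : 'I_n.+1 => f i.+1 (y (n - i)%N))); first exact: addIr.
  by move=> i _; rewrite IHm // (leq_ltn_trans (leq_subr i n)).
have surj_f x : exists y, extend1 f y = x.
  have [|n y _|y fy] := @dependent_sequence A 0 (fun n y => extend1 f y n = x n).
  - by move=> n u v uv <-; apply: extend1_causal => // i /uv.
  - case: n => [|n]; first by exists (x 0%N); rewrite extend1_coef0 f0.
    exists (x n.+1 - \sum_(i < n.+1) f i.+1 (y (n - i)%N)); rewrite coefS eqxx.
    rewrite [X in _ + X](eq_bigr (fun i : 'I_n.+1 => f i.+1 (y (n - i)%N))).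
      by rewrite subrK.
    by move=> i _; rewrite ifN // neq_ltn ltnS leq_subr.
  - by exists y; apply/funext.
have [g gK] := choice surj_f.
by exists g => // x; apply: inj_f; rewrite gK.
Qed.

End Series.

Lemma der_ord (V : nmodType) (N : nat) (d : 'I_N -> V -> V) (k : 'I_N) :
  der d k.+1 = d k.
Proof. by rewrite /der valK. Qed.

(** The condition [h 0 = 0] takes care of the default value of [der] beyond N. The cases of interest
    are the constant-term map and the embedding of A as constant series. *)
Lemma der_morph (V W : nmodType) (N : nat) (d : 'I_N -> V -> V)
    (d' : 'I_N -> W -> W) (h : V -> W) m x :
    h 0 = 0 -> (forall k y, h (d k y) = d' k (h y)) ->
  h (der d m x) = der d' m (h x).
Proof. by move=> h0 hd; case: m => //= m; case: insub => /=. Qed.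

(** * Cochains of degree one and two, and the vanishing of H^2 *)

Section LowDegree.
Set Implicit Arguments.
Unset Strict Implicit.
Variables (K : fieldType) (A : lmodType K) (N : nat).
Variables (mu : A -> A -> A) (d : 'I_N -> A -> A).
Hypothesis mu_bilinear : bilinear_op mu.

Definition nary1 (f : A -> A) : nary A 1 := fun a => f (a ord0).
Definition nary2 (f : A -> A -> A) : nary A 2 := fun a => f (a ord0) (a ord_max).

Lemma nary1_surj (g : nary A 1) : g = nary1 (fun u => g (fun=> u)).
Proof.
apply/funext => a; congr (g _); apply/funext => i; by rewrite (ord1 i).
Qed.

Lemma multilinear_nary1 f : multilinear (nary1 f) <-> linear f.
Proof.
split=> [linf c u v|linf a i c u v].
  exact: (linf (fun=> 0) ord0 c u v).
by rewrite /nary1 (ord1 i) eqxx linf.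
Qed.

Lemma multilinear_nary2 f : bilinear_op f -> multilinear (nary2 f).
Proof.
move=> blf a i c u v; rewrite /nary2.
have [->|->] : i = ord0 \/ i = ord_max.
  by case: i => -[|[|//]] lt_i; [left|right]; exact: val_inj.
- exact: blf.1.
- exact: blf.2.
Qed.

Lemma delta_nary1 f k a :
  delta d k (nary1 f) a = f (d k (a ord0)) - d k (f (a ord0)).
Proof.
(* A single index with total k+1 must be k+1 itself, the largest element of ['I_k.+2]. *)
rewrite /delta /nary1 (big_pred1 [ffun=> ord_max]) => [|i] /=.
  by rewrite ffunE -der_ord.
rewrite big_ord1 /=; apply/eqP/eqP => [ik|->]; last by rewrite ffunE.
by apply/ffunP => l; rewrite ffunE (ord1 l); exact: val_inj.
Qed.

Lemma delta_nary2 f k a :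
  delta d k (nary2 f) a =
    \sum_(i < k.+2) f (der d i (a ord0)) (der d (k.+1 - i) (a ord_max))
    - d k (f (a ord0) (a ord_max)).
Proof.
rewrite /delta; congr (_ - _).
(* A pair of indices with total k+1 is determined by its first entry [i]; the second is [rev_ord i],
   that is k+1-i. *)
rewrite (reindex_onto (fun i : 'I_k.+2 =>
    [ffun l : 'I_2 => if l == ord0 then i else rev_ord i]) (fun i => i ord0)) /=.
  apply: eq_big => i; last by rewrite /nary2 !ffunE.
  by rewrite !big_ord_recl big_ord0 !ffunE /= addn0 subSS subnKC ?eqxx // -ltnS.
move=> i /eqP; rewrite !big_ord_recl big_ord0 addn0 => sum_i.
apply/ffunP => l; rewrite ffunE; have [->//|l0] := eqVneq.
have -> : l = lift ord0 ord0 by case: l l0 => -[|[|//]] // lt_l _; exact: val_inj.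
apply: val_inj; apply/eqP.
by rewrite /= subSS -(eqn_add2l (i ord0)) sum_i subnKC // -ltnS.
Qed.

Lemma delta_Hoch_nary1 f a :
  delta_Hoch mu (nary1 f) a =
    mu (a ord0) (f (a ord_max)) - f (mu (a ord0) (a ord_max))
    + mu (f (a ord0)) (a ord_max).
Proof.
rewrite /delta_Hoch big_ord1 /nary1 /behead_arg /belast_arg /Defs.merge /=.
rewrite expr1 expr2 mulrNN mulr1 scale1r scaleN1r.
have -> : lift ord0 ord0 = ord_max :> 'I_2 by exact: val_inj.
by have -> : lift ord_max ord0 = ord0 :> 'I_2 by exact: val_inj.
Qed.

Lemma delta_Hoch_nary2 f (a : 'I_3 -> A) (i := lift ord0 ord0 : 'I_3) :
  delta_Hoch mu (nary2 f) a =
    mu (a ord0) (f (a i) (a ord_max)) - f (mu (a ord0) (a i)) (a ord_max)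
    + f (a ord0) (mu (a i) (a ord_max)) - mu (f (a ord0) (a i)) (a ord_max).
Proof.
rewrite /delta_Hoch !big_ord_recl big_ord0 /nary2 /behead_arg /belast_arg.
rewrite /Defs.merge /=.
have E2 : lift ord0 ord_max = ord_max :> 'I_3 by exact: val_inj.
have E1 : lift ord_max ord_max = i :> 'I_3 by exact: val_inj.
have E0 : lift ord_max ord0 = ord0 :> 'I_3 by exact: val_inj.
have E3 : lift ord_max (lift ord0 ord0) = i :> 'I_3 by exact: val_inj.
have E4 : lift ord0 (lift ord0 ord0) = ord_max :> 'I_3 by exact: val_inj.
rewrite E0 E1 E2 E3 E4 -/i !exprS expr0 !mulN1r !opprK.
by rewrite !scaleN1r scale1r addr0 !addrA.
Qed.

(** Setting f_0 = 0 pads both sums of the twisted coboundary, where the index of f starts at 1, to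
    the full range 0..k+1, so that they merge into one. *)
Lemma delta_Hoch'_nary1 (f : nat -> A -> A) (k : 'I_N) a :
    f 0%N = 0 ->
  delta_Hoch' mu d (fun j => nary1 (f j.+1)) k a =
    \sum_(i < k.+2) (mu (der d i (a ord0)) (f (k.+1 - i)%N (a ord_max))
                     + mu (f i (a ord0)) (der d (k.+1 - i) (a ord_max)))
    - f k.+1 (mu (a ord0) (a ord_max)).
Proof.
move=> f0; rewrite /delta_Hoch' big_ord1 /nary1 /behead_arg /belast_arg /Defs.merge /=.
have -> : lift ord0 ord0 = ord_max :> 'I_2 by exact: val_inj.
have -> : lift ord_max ord0 = ord0 :> 'I_2 by exact: val_inj.
rewrite expr1 expr2 mulrNN mulr1 scale1r scaleN1r addrAC big_split /=.
congr (_ + _ + _).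
  (* The padding term is the last one here (i = k+1) and the first one in the other sum (i = 0).
     Since k < N, the sums over ['I_N] cut at k are sums over ['I_k.+1]. *)
  rewrite [RHS]big_ord_recr /= subnn f0 (linear_map0 (mu_bilinear.2 _)) addr0.
  transitivity (\sum_(j < k.+1) mu (der d (k - j) (a ord0)) (f j.+1 (a ord_max))).
    exact/esym/(big_ord_widen N (fun j => mu (der d (k - j) _) (f j.+1 _))).
  rewrite [RHS](reindex_inj rev_ord_inj); apply: eq_bigr => j _.
  by rewrite /= subSS subSn ?leq_subr // subKn // -ltnS.
rewrite [RHS]big_ord_recl f0 (linear_map0 (mu_bilinear.1 _)) add0r.
exact/esym/(big_ord_widen N (fun i => mu (f i.+1 _) (der d (k - i) _))).
Qed.

Hypothesis H2_eq0 : cohomology_eq0 mu d 2.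

(** The two identities assumed of [P] and [Q] are the components of the 2-cocycle equation for (P;
    Q_1, ..., Q_N), with all terms moved to positive sign. The conclusion unfolds (P; Q) =
    (delta_Hoch f; -delta_k f). *)
Lemma cocycle_primitive (P : A -> A -> A) (Q : nat -> A -> A) :
    bilinear_op P -> (forall i, linear (Q i)) -> Q 0%N = 0 ->
    (forall a b c, mu (P a b) c + P (mu a b) c = mu a (P b c) + P a (mu b c)) ->
    (forall (k : 'I_N) a b, Q k.+1 (mu a b) + d k (P a b) =
      \sum_(i < k.+2) P (der d i a) (der d (k.+1 - i) b)
      + \sum_(i < k.+2) (mu (der d i a) (Q (k.+1 - i)%N b)
                         + mu (Q i a) (der d (k.+1 - i) b))) ->
  exists f, [/\ linear f,
    forall a b, P a b = mu a (f b) - f (mu a b) + mu (f a) b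
    & forall (k : 'I_N) a, Q k.+1 a = d k (f a) - f (d k a)].
Proof.
move=> blP linQ Q0 Passoc Qder.
pose c : precochain A N 2 := (nary2 P, fun k : 'I_N => nary1 (Q k.+1)).
have [|g cg dg] := @H2_eq0 c.
  split; first by split=> [|k]; [exact: multilinear_nary2 | apply/multilinear_nary1].
  congr (_, _); apply/funext.
    move=> a; rewrite /= delta_Hoch_nary2; apply/eqP.
    by rewrite subr_eq0 addrAC subr_eq -Passoc addrC.
  move=> k; apply/funext => a.
  rewrite /= expr2 mulrNN mulr1 scale1r.
  transitivity (delta_Hoch' mu d (fun j => nary1 (Q j.+1)) k a
                + delta d k (nary2 P) a) => //.
  rewrite delta_Hoch'_nary1 // delta_nary2 addrACA -opprD Qder [X in _ - X]addrC.
  exact: subrr.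
(* The primitive is a 1-cochain on families indexed by ['I_1]; it is read as a unary map. *)
move: dg; rewrite (nary1_surj g) => -[dP dQ].
exists (fun u => g (fun=> u)); split.
- by apply/multilinear_nary1; rewrite -nary1_surj.
- move=> a b; pose ab (i : 'I_2) := if i == ord0 then a else b.
  by have := congr1 (@^~ ab) dP; rewrite delta_Hoch_nary1 /nary2 => ->.
- move=> k a; have := congr1 (fun F : 'I_N -> nary A 1 => F k (fun=> a)) dQ.
  rewrite /nary1 => <-.
  transitivity (- delta d k (nary1 (fun u => g (fun=> u))) (fun=> a)) => //.
  by rewrite delta_nary1 opprB.
Qed.

End LowDegree.

(** * Constant series and lowest-order coefficients *)

Section ConstantSeries.
Set Implicit Arguments.
Unset Strict Implicit.
Variables (K : fieldType) (A : lmodType K).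

Lemma coef_sum (n m : nat) (h : 'I_m -> pseries A) :
  (\sum_i h i) n = \sum_i h i n.
Proof. exact: (big_morph (fun x : pseries A => x n)). Qed.

Lemma linear_cst0 : linear (fun _ : A => 0 : A).
Proof. by move=> c x y; rewrite scaler0 addr0. Qed.

Lemma const_series_linear (f : A -> A) :
  linear f -> forall i, linear (const_series f i).
Proof. by move=> linf [|i] //; exact: linear_cst0. Qed.

Lemma const_series_bilinear (mu : A -> A -> A) :
  bilinear_op mu -> forall i, bilinear_op (const_series mu i).
Proof. by move=> blmu [|i] //; split=> x; exact: linear_cst0. Qed.

Lemma extend1_const_const (f : A -> A) a : linear f ->
  extend1 (const_series f) (const_series a) = const_series (f a).
Proof.
move=> linf; rewrite extend1_const; last exact: const_series_linear.
by apply/funext => -[].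
Qed.

Lemma extend2_const_const (mu : A -> A -> A) a b : bilinear_op mu ->
  extend2 (const_series mu) (const_series a) (const_series b) = const_series (mu a b).
Proof.
move=> blmu; rewrite extend2_const; last exact: const_series_bilinear.
by apply/funext => -[].
Qed.

Lemma extend1_order (f : nat -> A -> A) (x : pseries A) n :
    (forall i, linear (f i)) -> (forall m, (m < n)%N -> x m = 0) ->
  extend1 f x n = f 0%N (x n).
Proof.
move=> linf x0; rewrite (tlinear_order (tlinear_extend1 linf) x0).
by rewrite extend1_coef0 addn0.
Qed.

Lemma extend2_orderl (m : nat -> A -> A -> A) (x y : pseries A) n :
    (forall i, bilinear_op (m i)) -> (forall p, (p < n)%N -> x p = 0) ->
  extend2 m x y n = m 0%N (x n) (y 0%N).
Proof.
move=> blm x0; rewrite (tlinear_order (tlinear_extend2l y blm) x0).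
by rewrite extend2_coef0 addn0.
Qed.

Lemma extend2_orderr (m : nat -> A -> A -> A) (x y : pseries A) n :
    (forall i, bilinear_op (m i)) -> (forall p, (p < n)%N -> y p = 0) ->
  extend2 m x y n = m 0%N (x 0%N) (y n).
Proof.
move=> blm y0; rewrite (tlinear_order (tlinear_extend2r x blm) y0).
by rewrite extend2_coef0 addn0.
Qed.

End ConstantSeries.

(** * The undeformed pair extended to A[[t]] *)

Section DerSeries.
Set Implicit Arguments.
Unset Strict Implicit.
Variables (K : fieldType) (A : lmodType K) (N : nat).

Lemma tlinear_der (D : 'I_N -> pseries A -> pseries A) m :
  (forall k, tlinear (D k)) -> tlinear (der D m).
Proof.
move=> tD; case: m => [|m]; first exact: tlinear_id.
by rewrite /der; case: insub => [k|] /=; [exact: tD | exact: tlinear0].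
Qed.

(** Both sides of each identity are t-linear in every variable, so [tlinear_eq] reduces them, one
    variable at a time, to constant series, where they are the identities of A. *)
Lemma AssHDer_pair_const (mu : A -> A -> A) (d : 'I_N -> A -> A) :
  AssHDer_pair mu d ->
  AssHDer_pair (extend2 (const_series mu)) (fun k => extend1 (const_series (d k))).
Proof.
move=> [blmu muA [lind dM]].
have tl y := @tlinear_extend2l _ _ _ y (const_series_bilinear blmu).
have tr x := @tlinear_extend2r _ _ _ x (const_series_bilinear blmu).
have td k := tlinear_extend1 (const_series_linear (lind k)).
have tder m := tlinear_der m td.
split; first by split=> x; [exact: (tl _).1 | exact: (tr _).1].
  move=> x y z; move: x; apply: tlinear_eq => [||a].
  - exact: tl.
  - exact: tlinear_comp (tl _) (tl _).
  move: y; apply: tlinear_eq => [||b].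
  - exact: tlinear_comp (tr _) (tl _).
  - exact: tlinear_comp (tl _) (tr _).
  move: z; apply: tlinear_eq => [||c].
  - exact: tlinear_comp (tr _) (tr _).
  - exact: tr.
  by rewrite !extend2_const_const // muA.
split=> [k|k x y]; first exact: (td k).1.
have der_const m a : der (fun k => extend1 (const_series (d k))) m (const_series a)
                     = const_series (der d m a).
  apply/esym/der_morph; first by apply/funext => -[].
  by move=> j b; rewrite extend1_const_const.
move: x; apply: tlinear_eq => [||a].
- exact: tlinear_comp (td k) (tl _).
- by apply: tlinear_sum => i; exact: tlinear_comp (tl _) (tder _).
move: y; apply: tlinear_eq => [||b].
- exact: tlinear_comp (td k) (tr _).
- by apply: tlinear_sum => i; exact: tlinear_comp (tr _) (tder _).
rewrite extend2_const_const // extend1_const_const // dM.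
apply/funext => n; rewrite coef_sum.
under [RHS]eq_bigr => i _ do rewrite !der_const extend2_const_const //.
by case: n => [|n] /=; rewrite // big1.
Qed.

End DerSeries.

(** * Failure of a series [Phi] to be a morphism of pairs *)

Section Defects.
Set Implicit Arguments.
Unset Strict Implicit.
Variables (K : fieldType) (A : lmodType K) (N : nat).
Variables (mu : A -> A -> A) (d : 'I_N -> A -> A).
Variables (mut : nat -> A -> A -> A) (dt : 'I_N -> nat -> A -> A).
Hypothesis pairA : AssHDer_pair mu d.
Hypothesis deform : deformation mu d mut dt.
Implicit Types (Phi : nat -> A -> A) (x y z : pseries A) (a b : A).

Local Notation cst := (@const_series K A).
Local Notation M0 := (extend2 (const_series mu)).
Local Notation D0 := (der (fun k => extend1 (const_series (d k)))).
Local Notation Mt := (extend2 mut).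
Local Notation Dt := (der (fun k => extend1 (dt k))).

Definition mul_defect Phi x y : pseries A :=
  extend1 Phi (Mt x y) - M0 (extend1 Phi x) (extend1 Phi y).

(** Here [k] is indexed as in [der]: the defect of index 0 is zero, which matches the padding
    [Q 0 = 0] of [cocycle_primitive]. *)
Definition der_defect Phi k x : pseries A :=
  extend1 Phi (Dt k x) - D0 k (extend1 Phi x).

Let bl_mu := AssHDer_bilinear pairA.
Let lin_d := (AssHDer_higher_derivation pairA).1.
Let pair0 := AssHDer_pair_const pairA.
Let pairt := deform_AssHDer deform.
Let bl_mut := deform_bilinear deform.
Let tM0l y := @tlinear_extend2l _ _ _ y (const_series_bilinear bl_mu).
Let tM0r x := @tlinear_extend2r _ _ _ x (const_series_bilinear bl_mu).
Let tMtl y := @tlinear_extend2l _ _ _ y bl_mut.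
Let tMtr x := @tlinear_extend2r _ _ _ x bl_mut.
Let tD0 k := tlinear_der k (fun j => tlinear_extend1 (const_series_linear (lin_d j))).
Let tDt k := tlinear_der k (fun j => tlinear_extend1 (deform_linear deform j)).

Lemma Dt_coef0 k x : Dt k x 0%N = der d k (x 0%N).
Proof.
apply: (der_morph (h := fun x : pseries A => x 0%N)) => // j y.
by rewrite extend1_coef0 (deform_d0 deform).
Qed.

Lemma D0_coef0 k x : D0 k x 0%N = der d k (x 0%N).
Proof.
apply: (der_morph (h := fun x : pseries A => x 0%N)) => // j y.
by rewrite extend1_coef0.
Qed.

Lemma Mt_coef0 x y : Mt x y 0%N = mu (x 0%N) (y 0%N).
Proof. by rewrite extend2_coef0 (deform_mu0 deform). Qed.

Lemma mul_defect_causal Phi Phi' x y n :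
    (forall i, (i <= n)%N -> Phi i = Phi' i) ->
  mul_defect Phi x y n = mul_defect Phi' x y n.
Proof.
move=> eqPhi; rewrite /mul_defect !coefD !coefN; congr (_ - _).
  exact: extend1_causal.
by apply: extend2_causal => i le_in; apply: extend1_causal => // j le_ji;
   rewrite eqPhi // (leq_trans le_ji).
Qed.

Lemma der_defect0 Phi : der_defect Phi 0 = 0.
Proof. by apply/funext => x; exact: subrr. Qed.

Section LinearDefect.
Variable Phi : nat -> A -> A.
Hypothesis lin_Phi : forall i, linear (Phi i).

Let tPhi := tlinear_extend1 lin_Phi.

Lemma tlinear_mul_defectl y : tlinear (fun x => mul_defect Phi x y).
Proof.
exact: tlinear_sub (tlinear_comp tPhi (tMtl y)) (tlinear_comp (tM0l _) tPhi).
Qed.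

Lemma tlinear_mul_defectr x : tlinear (mul_defect Phi x).
Proof.
exact: tlinear_sub (tlinear_comp tPhi (tMtr x)) (tlinear_comp (tM0r _) tPhi).
Qed.

Lemma tlinear_der_defect k : tlinear (der_defect Phi k).
Proof.
exact: tlinear_sub (tlinear_comp tPhi (tDt k)) (tlinear_comp (tD0 k) tPhi).
Qed.

Lemma der_defect_ord_eq0 x n :
    (forall k : 'I_N, der_defect Phi k.+1 x n = 0) ->
  forall k, der_defect Phi k x n = 0.
Proof.
move=> G0 [|k]; first by rewrite der_defect0.
have [lt_kN|le_Nk] := ltnP k N; first exact: (G0 (Ordinal lt_kN)).
(* Beyond N both derivations take the default value 0, and [extend1 Phi] maps 0 to 0. *)
rewrite /der_defect /der insubN /= -?leqNgt // (linear_map0 tPhi.1).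
exact: subrr.
Qed.

(** The mixed terms cancel: the left side is Phi((xy)z) - (Phi x Phi y) Phi z and the right side is
    Phi(x(yz)) - Phi x (Phi y Phi z). *)
Lemma mul_defect_assoc x y z :
  M0 (mul_defect Phi x y) (extend1 Phi z) + mul_defect Phi (Mt x y) z
  = M0 (extend1 Phi x) (mul_defect Phi y z) + mul_defect Phi x (Mt y z).
Proof.
rewrite /mul_defect (linear_mapB (tM0l _).1) (linear_mapB (tM0r _).1).
rewrite -(AssHDer_associative pair0) -(AssHDer_associative pairt).
by rewrite [LHS]addrC [RHS]addrC !addrA !subrK.
Qed.

(** Both sides telescope to Phi(D_t(xy)) - D_0(Phi x Phi y), of index k+1. On the right, the mixed
    products cancel for each [i] once both derivation rules are expanded. *)
Lemma mul_defect_der (k : 'I_N) x y :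
  der_defect Phi k.+1 (Mt x y) + D0 k.+1 (mul_defect Phi x y)
  = \sum_(i < k.+2) mul_defect Phi (Dt i x) (Dt (k.+1 - i) y)
    + \sum_(i < k.+2)
        (M0 (D0 i (extend1 Phi x)) (der_defect Phi (k.+1 - i) y)
         + M0 (der_defect Phi i x) (extend1 Phi (Dt (k.+1 - i) y))).
Proof.
rewrite /mul_defect /der_defect (linear_mapB (tD0 _).1) addrA subrK -big_split /=.
rewrite valK /=.
rewrite (AssHDer_higher_derivation pairt).2 (AssHDer_higher_derivation pair0).2.
have -> : extend1 Phi (\sum_(i < k.+2) Mt (Dt i x) (Dt (k.+1 - i) y))
          = \sum_(i < k.+2) extend1 Phi (Mt (Dt i x) (Dt (k.+1 - i) y)).
  apply: big_morph => [u v|]; first exact: (linear_mapD tPhi.1).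
  exact: (linear_map0 tPhi.1).
rewrite -sumrB; apply: eq_bigr => i _.
rewrite (linear_mapB (tM0l _).1) (linear_mapB (tM0r _).1).
by rewrite [X in _ = _ + X]addrC !addrA !subrK.
Qed.

(** * The lowest-order defect is a 2-cocycle and can be removed *)

Section Obstruction.
Variable n : nat.
Hypothesis Phi0 : Phi 0%N = idfun.
Hypothesis mul_defect_lt : forall a b m,
  (m < n)%N -> mul_defect Phi (cst a) (cst b) m = 0.
Hypothesis der_defect_lt : forall k a m,
  (m < n)%N -> der_defect Phi k (cst a) m = 0.

Let Phi_coef0 x : extend1 Phi x 0%N = x 0%N.
Proof. by rewrite extend1_coef0 Phi0. Qed.

Lemma mul_defect_lead x y m : (m <= n)%N ->
  mul_defect Phi x y m = mul_defect Phi (cst (x 0%N)) (cst (y 0%N)) m.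
Proof.
by apply: bitlinear_lead mul_defect_lt _ _ _;
  [exact: tlinear_mul_defectl | exact: tlinear_mul_defectr].
Qed.

Lemma der_defect_lead k x m : (m <= n)%N ->
  der_defect Phi k x m = der_defect Phi k (cst (x 0%N)) m.
Proof. exact: (tlinear_lead (tlinear_der_defect k) (der_defect_lt k)). Qed.

(** A defect vanishes below order [n], so in a product with it only the constant term of the other
    factor reaches order [n]; inside a defect only the constant terms of the arguments count. As
    Phi, mu_t and d_{k,t} start with id, mu and d_k, the two defect identities become the cocycle
    equations. *)
Lemma obstruction_primitive (H2_eq0 : cohomology_eq0 mu d 2) :
  exists f, [/\ linear f,
    forall a b, mul_defect Phi (cst a) (cst b) n
                = mu a (f b) - f (mu a b) + mu (f a) b
    & forall (k : 'I_N) a,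
        der_defect Phi k.+1 (cst a) n = d k (f a) - f (d k a)].
Proof.
have F0 x y m : (m < n)%N -> mul_defect Phi x y m = 0.
  by move=> lt_mn; rewrite mul_defect_lead ?mul_defect_lt // ltnW.
have G0 k x m : (m < n)%N -> der_defect Phi k x m = 0.
  by move=> lt_mn; rewrite der_defect_lead ?der_defect_lt // ltnW.
have bl0 := const_series_bilinear bl_mu.
apply: (cocycle_primitive bl_mu H2_eq0
  (P := fun a b => mul_defect Phi (cst a) (cst b) n)
  (Q := fun k a => der_defect Phi k (cst a) n)).
- split=> [b|a] c u v; rewrite linear_const_series.
    by rewrite ((tlinear_mul_defectl _).1 c).
  by rewrite ((tlinear_mul_defectr _).1 c).
- by move=> k c u v; rewrite linear_const_series ((tlinear_der_defect k).1 c).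
- by rewrite der_defect0.
- move=> a b c.
  have := congr1 (@^~ n) (mul_defect_assoc (cst a) (cst b) (cst c)).
  rewrite !coefD (extend2_orderl _ bl0 (F0 _ _)) (extend2_orderr _ bl0 (F0 _ _)).
  rewrite (mul_defect_lead (Mt _ _)) // (mul_defect_lead _ (Mt _ _)) //.
  by rewrite !Phi_coef0 !Mt_coef0.
- move=> k a b.
  have := congr1 (@^~ n) (mul_defect_der k (cst a) (cst b)).
  rewrite !coefD !coef_sum der_defect_lead // Mt_coef0 der_ord.
  rewrite (extend1_order (const_series_linear (lin_d k)) (F0 _ _)) => ->.
  congr (_ + _); apply: eq_bigr => i _.
    by rewrite mul_defect_lead // !Dt_coef0.
  rewrite coefD (extend2_orderr _ bl0 (G0 _ _)) (extend2_orderl _ bl0 (G0 _ _)).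
  by rewrite D0_coef0 !Phi_coef0 Dt_coef0.
Qed.

Hypothesis n_gt0 : (0 < n)%N.

(** Adding t^n f to Phi changes the order-n coefficient of F by f(ab) - f(a)b - a f(b) and that of
    G_k by f(d_k a) - d_k(f a), exactly the opposites of the defects. Positivity of [n] keeps the
    constant term equal to the identity. *)
Lemma correction (H2_eq0 : cohomology_eq0 mu d 2) :
  exists f, let Phi' := fun i => if i == n then (fun a => Phi n a + f a) else Phi i in
    [/\ linear f,
    forall a b, mul_defect Phi' (cst a) (cst b) n = 0
    & forall (k : 'I_N) a, der_defect Phi' k.+1 (cst a) n = 0].
Proof.
have [f [linf dmul dder]] := obstruction_primitive H2_eq0.
exists f; set Phi' := fun i => _.
(* [Psi] is the operator t^n f. *)
pose Psi := extend1 (fun i => if i == n then f else fun=> 0).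
have lin_psi i : linear (if i == n then f else fun=> 0).
  by case: ifP => _ //; exact: linear_cst0.
have lin_Phi' i : linear (Phi' i).
  rewrite /Phi'; case: ifP => _; last exact: lin_Phi.
  by move=> c u v; rewrite lin_Phi linf scalerDr addrACA.
have Phi'E x : extend1 Phi' x = extend1 Phi x + Psi x.
  apply/funext => m; rewrite coefD -big_split; apply: eq_bigr => i _ /=.
  by rewrite /Phi'; case: eqP => [->|] //=; rewrite addr0.
have Psi_lt x m : (m < n)%N -> Psi x m = 0.
  move=> lt_mn; apply: big1 => i _; rewrite ifN // neq_ltn.
  by rewrite (leq_ltn_trans _ lt_mn) // -ltnS.
have Psi_n x : Psi x n = f (x 0%N).
  rewrite /Psi /extend1 big_ord_recr /= eqxx subnn big1 ?add0r // => i _.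
  by rewrite ifN // neq_ltn ltn_ord.
have bl0 := const_series_bilinear bl_mu.
have Phi'_coef0 x : extend1 Phi' x 0%N = x 0%N.
  by rewrite extend1_coef0 /Phi' ifN ?Phi0 // eq_sym -lt0n.
split=> // [a b|k a].
  (* The product is expanded asymmetrically, with [Phi'] kept in one factor, so the quadratic term
     in [Psi] never appears separately. *)
  have -> : mul_defect Phi' (cst a) (cst b) = mul_defect Phi (cst a) (cst b)
      + (Psi (Mt (cst a) (cst b)) - M0 (Psi (cst a)) (extend1 Phi' (cst b))
         - M0 (extend1 Phi (cst a)) (Psi (cst b))).
    have Phi'b : M0 (extend1 Phi (cst a)) (extend1 Phi' (cst b))
                 = M0 (extend1 Phi (cst a)) (extend1 Phi (cst b))
                   + M0 (extend1 Phi (cst a)) (Psi (cst b)).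
      by rewrite Phi'E (linear_mapD (tM0r _).1).
    rewrite /mul_defect (Phi'E (cst a)) (Phi'E (Mt _ _)) (linear_mapD (tM0l _).1).
    rewrite Phi'b opprD addrACA opprD [X in X + _ = _]addrA [LHS]addrAC.
    exact/esym/addrA.
  rewrite !coefD !coefN Psi_n (extend2_orderl _ bl0 (Psi_lt _)).
  rewrite (extend2_orderr _ bl0 (Psi_lt _)) !Psi_n Phi'_coef0 Phi_coef0 Mt_coef0 /=.
  by apply/eqP; rewrite dmul addr_eq0 !opprB addrA addrAC.
have -> : der_defect Phi' k.+1 (cst a) = der_defect Phi k.+1 (cst a)
    + (Psi (Dt k.+1 (cst a)) - D0 k.+1 (Psi (cst a))).
  by rewrite /der_defect !Phi'E (linear_mapD (tD0 _).1) opprD addrACA.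
rewrite !coefD !coefN Psi_n Dt_coef0 dder !der_ord.
rewrite (extend1_order (const_series_linear (lin_d k)) (Psi_lt _)) Psi_n.
by rewrite /= addrA subrK subrr.
Qed.

End Obstruction.
End LinearDefect.

(** * Recursive construction of the equivalence *)

Lemma der_defect_causal Phi Phi' (k : 'I_N) x n :
    (forall i, (i <= n)%N -> Phi i = Phi' i) ->
  der_defect Phi k.+1 x n = der_defect Phi' k.+1 x n.
Proof.
move=> eqPhi; rewrite /der_defect !der_ord !coefD !coefN.
congr (_ - _); first exact: extend1_causal.
by apply: extend1_causal => // i le_in; apply: extend1_causal => // j le_ji;
   rewrite eqPhi // (leq_trans le_ji).
Qed.

Lemma trivializing_series (H2_eq0 : cohomology_eq0 mu d 2) :
  exists Phi, forall n, [/\ linear (Phi n), n = 0%N -> Phi 0%N = idfun,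
    forall a b, mul_defect Phi (cst a) (cst b) n = 0
    & forall (k : 'I_N) a, der_defect Phi k.+1 (cst a) n = 0].
Proof.
(* Every clause of [good n] depends on Phi_0, ..., Phi_n alone, as [dependent_sequence] demands. *)
pose good n (Phi : nat -> A -> A) := [/\ linear (Phi n),
    n = 0%N -> Phi 0%N = idfun,
    forall a b, mul_defect Phi (cst a) (cst b) n = 0
    & forall (k : 'I_N) a, der_defect Phi k.+1 (cst a) n = 0].
have good_causal n u v : (forall i, (i <= n)%N -> u i = v i) -> good n u -> good n v.
  move=> uv [lin_un u0 Fu Gu]; split.
  - by rewrite -uv.
  - by move=> n0; rewrite -uv // u0.
  - by move=> a b; rewrite -(mul_defect_causal _ _ uv).
  - by move=> k a; rewrite -(der_defect_causal k _ uv).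
apply: (@dependent_sequence (A -> A) idfun good) => [|n u good_u].
  exact: good_causal.
have [n0|n_gt0] := posnP n.
  (* At order 0 the identity works because mu_t and d_{k,t} start with mu and d_k. *)
  exists idfun; rewrite n0; split=> // [a b|k a].
    by rewrite /mul_defect coefD coefN extend1_coef0 Mt_coef0 extend2_coef0
               !extend1_coef0 /= subrr.
  by rewrite /der_defect coefD coefN !extend1_coef0 Dt_coef0 D0_coef0
             extend1_coef0 /= subrr.
(* Nothing is known about [u] from index [n] on, while [correction] requires every coefficient to be
   linear; hence the truncation. Since [w n] is zero, the corrected coefficient is [f] itself. *)
pose w i : A -> A := if (i < n)%N then u i else fun=> 0.
have wu i : (i < n)%N -> w i = u i by rewrite /w => ->.
have lin_w i : linear (w i).
  rewrite /w; case: ifP => [lt_in|_]; first by have [] := good_u i lt_in.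
  exact: linear_cst0.
have good_w m : (m < n)%N -> good m w.
  move=> lt_mn; apply: good_causal (good_u m lt_mn) => i le_im.
  by rewrite wu // (leq_ltn_trans le_im).
have w0 : w 0%N = idfun by have [_ ->] := good_w 0%N n_gt0.
have Fw a b m : (m < n)%N -> mul_defect w (cst a) (cst b) m = 0.
  by move=> /good_w[_ _ ->].
have Gw k a m : (m < n)%N -> der_defect w k (cst a) m = 0.
  by move=> /good_w[_ _ _ Gw]; exact: (der_defect_ord_eq0 lin_w).
have [f /= [linf Fw' Gw']] := correction lin_w w0 Fw Gw n_gt0 H2_eq0.
exists f; apply: good_causal (_ : good n (fun i =>
  if i == n then fun a => w n a + f a else w i)).
  move=> i le_in; case: eqP => [_|/eqP ne_in].
    by apply/funext => a; rewrite /w ltnn [LHS]add0r.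
  by rewrite wu // ltn_neqAle ne_in.
split=> [|n0|//|k a]; last exact: Gw'.
  by rewrite eqxx /w ltnn => c x y; rewrite !add0r linf.
by rewrite n0 in n_gt0.
Qed.

End Defects.

Theorem theorem6p6 (K : fieldType) (charK : [pchar K] =i pred0)
    (N : nat) (N_ge1 : (1 <= N)%N) (A : lmodType K)
    (mu : A -> A -> A) (d : 'I_N -> A -> A) (pairA : AssHDer_pair mu d)
    (H2_eq0 : cohomology_eq0 mu d 2)
    (mut : nat -> A -> A -> A) (dt : 'I_N -> nat -> A -> A)
    (deform : deformation mu d mut dt) :
  trivial_deformation mu d mut dt.
Proof.
have [Phi PhiP] := trivializing_series pairA deform H2_eq0.
have linPhi i : linear (Phi i) by have [] := PhiP i.
have Phi0 : Phi 0%N = idfun by have [_ ->] := PhiP 0%N.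
(* The defects vanish on constants at every order; the bound [n] only gives the shape expected by
   the lemmas on leading coefficients. *)
have F0 n a b m : (m < n)%N ->
    mul_defect mu mut Phi (const_series a) (const_series b) m = 0.
  by have [_ _ ->] := PhiP m.
have G0 n k a m : (m < n)%N -> der_defect d dt Phi k (const_series a) m = 0.
  move=> _; apply: (der_defect_ord_eq0 linPhi) => j.
  by have [_ _ _ ->] := PhiP m.
exists Phi; split=> // [|x y|k x].
- exact: extend1_bijective.
(* Vanishing on constants below order n+1 carries the coefficient of order n over to arbitrary
   series. *)
- apply/subr0_eq/funext => n.
  have := mul_defect_lead pairA deform linPhi (F0 n.+1) x y (leqnSn n).
  by rewrite (F0 n.+1).
- apply/esym/subr0_eq/funext => n.
  have := der_defect_lead pairA deform linPhi (G0 n.+1) k.+1 x (leqnSn n).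
  by rewrite (G0 n.+1) // /der_defect !der_ord.
Qed.
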